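(* For $p>0$ and $q>0$, let $X_{p,q}$ denote a beta random variable with probability density function $$f_{p,q}(x)=\frac{\Gamma(p+q)}{\Gamma(p)\Gamma(q)}x^{p-1}(1-x)^{q-1},\qquad 0<x<1.$$ Then for every real $y>0$, $$\inf_{p>0,\,q>0}\mathbf{P}\left(|X_{p,q}-\mathbf{E}[X_{p,q}]|\ge y\sqrt{\mathrm{Var}(X_{p,q})}\right)=0.$$
   Context: $\mathbf{P}$, $\mathbf{E}$ and $\mathrm{Var}$ denote probability, expectation and variance; $\Gamma$ is the Euler Gamma function. The density is $0$ outside the indicated range. *)

(* Defs.v *)
From HB Require Import structures.
From mathcomp Require Import all_boot all_order all_algebra.
From mathcomp Require Import all_classical all_reals all_analysis.

Set Implicit Arguments.
Unset Strict Implicit.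
Unset Printing Implicit Defensive.

Import Order.TTheory GRing.Theory Num.Theory.
Import numFieldNormedType.Exports.

Local Open Scope classical_set_scope.
Local Open Scope ring_scope.

(* Meaningful for [0 < p]: elsewhere the integral diverges and [Rintegral]
   returns a default value. *)
Definition Gamma (R : realType) (p : R) : R :=
  \int[lebesgue_measure]_(t in `]0, +oo[) (t `^ (p - 1) * expR (- t)).

(* The library's [beta_pdf] only covers natural-number parameters. *)
Definition real_beta_pdf (R : realType) (p q : R) : R -> R :=
  (fun x => Gamma (p + q) / (Gamma p * Gamma q) *
            (x `^ (p - 1) * (1 - x) `^ (q - 1))) \_ `]0, 1[.

Definition has_pdf (d : measure_display) (T : measurableType d) (R : realType)
    (P : probability T R) (X : {RV P >-> R}) (f : R -> R) : Prop :=
  forall A : set R, measurable A ->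
    distribution P X A = (\int[lebesgue_measure]_(x in A) (f x)%:E)%E.

(* Main.v *)
Require Import Defs.
From HB Require Import structures.
From mathcomp Require Import all_boot all_order all_algebra.
From mathcomp Require Import all_classical all_reals all_analysis.
From mathcomp Require Import measurable_realfun.
From mathcomp Require Import ring lra.

Set Implicit Arguments.
Unset Strict Implicit.
Unset Printing Implicit Defensive.

Import Order.TTheory GRing.Theory Num.Theory.
Import numFieldNormedType.Exports.

Local Open Scope classical_set_scope.
Local Open Scope ring_scope.

(** The infimum is approached along [q = 1], [p -> 0]. There [X] has density
    [p * x ^ (p - 1)] on [(0, 1)] and tail [P (X > t) = 1 - t ^ p]. As [p]
    tends to [0] the mass piles up near [0], the mean being of order [p], but
    the mass remaining in [(1/2, 1)] is still of order [p], so the standard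
    deviation is of order [sqrt p], much larger than the mean. Hence, as soon
    as [X <= p], the deviation [`|X - E X|] is eventually smaller than
    [y * sigma], and the event in question has probability at most
    [P (X > p) = 1 - p ^ p], which tends to [0].

    Only the tail function is needed to make this quantitative. The mean is
    controlled by [`|E X| <= t + P (X > t)] at [t = p] ([normr_mean_le]); the
    variance is bounded below by Chebyshev's inequality read backwards,
    [Var X >= P (X > 1/2) / 16] ([tail_half_le_variance]). With the
    parametrisation [p = s ^ 4] every error term becomes polynomial:
    [1 - p ^ p <= 4 s ^ 3], the mean is at most [5 s ^ 3], and the standard
    deviation is at least [s ^ 2 / 7] ([power_law_concentration]).

    The value [Gamma (p + 1) / (Gamma p * Gamma 1) = p] is never computed: a
    density proportional to [x ^ (p - 1)] has a tail proportional to
    [1 - t ^ p], and right-continuity of the tail at [0] forces the factor to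
    be [1] ([power_ccdf]). *)

(** * The power law on the unit interval *)

(** The normalising constant [C] is left free: being a density already
    determines it. *)
Definition power_pdf (R : realType) (C p : R) : R -> R :=
  (fun x => C * x `^ (p - 1)) \_ `]0, 1[.

Lemma real_beta_pdf1 (R : realType) (p : R) :
  real_beta_pdf p 1 = power_pdf (Gamma (p + 1) / (Gamma p * Gamma 1)) p.
Proof.
rewrite /real_beta_pdf /power_pdf; congr (_ \_ _).
by apply/funext => x; rewrite subrr powRr0 mulr1.
Qed.

(** The lower endpoint [t] stays positive because the integrand is unbounded at
    [0] when [p < 1]; the mass near [0] is recovered later by a limit. *)
Lemma integral_powR (R : realType) (C p t : R) : 0 < p -> 0 < t < 1 ->
  (\int[lebesgue_measure]_(x in `[t, 1%R]) (C * x `^ (p - 1))%R%:E)%E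
  = (C / p * (1 - t `^ p))%:E.
Proof.
move=> p0 /andP[t0 t1].
have gt0 (x : R) : x \in `[t, 1] -> 0 < x.
  by rewrite in_itv/= => /andP[tx _]; apply: lt_le_trans tx.
have dF (a c x : R) : 0 < x ->
    is_derive x 1 (fun u => c * u `^ a) (c * (a * x `^ (a - 1))).
  by move=> x0; apply: is_deriveZ; exact: is_derive1_powR.
have cF (a c x : R) : 0 < x -> {for x, continuous (fun u => c * u `^ a)}.
  move=> x0; apply/differentiable_continuous/derivable1_diffP.
  by have [] := dF a c x x0.
rewrite (@continuous_FTC2 _ _ (fun x => C / p * x `^ p))//.
- by rewrite powR1 -EFinB -mulrBr.
- apply: continuous_in_subspaceT => x; rewrite inE/= => /gt0.
  exact: cF.
- split.
  + move=> x xt; have x0 : 0 < x by apply/gt0/(subset_itv_oo_cc xt).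
    by have [] := dF p (C / p) x x0.
  + by apply: cvg_at_right_filter; apply: cF.
  + by apply: cvg_at_left_filter; apply: cF.
- move=> x xt; have x0 : 0 < x by apply/gt0/(subset_itv_oo_cc xt).
  have [_ e] := dF p (C / p) x x0.
  by rewrite derive1E e mulrA divfK// gt_eqF.
Qed.

Lemma power_pdf_support (d : measure_display) (T : measurableType d)
    (R : realType) (P : probability T R) (X : {RV P >-> R}) (C p : R)
    (A : set R) : has_pdf X (power_pdf C p) -> measurable A ->
  distribution P X (A `&` `]0, 1[) = distribution P X A.
Proof.
move=> hX mA; rewrite !hX//; last exact: measurableI.
rewrite integral_mkcondr; apply: eq_integral => x _.
by rewrite /power_pdf /patch; case: ifPn => // ->.
Qed.

Lemma power_ccdf_unnormalised (d : measure_display) (T : measurableType d)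
    (R : realType) (P : probability T R) (X : {RV P >-> R}) (C p t : R) :
  0 < p -> has_pdf X (power_pdf C p) -> 0 < t < 1 ->
  ccdf X t = (C / p * (1 - t `^ p))%:E.
Proof.
move=> p0 hX /[dup] t01 /andP[t0 t1]; rewrite -integral_powR// /ccdf.
rewrite -(power_pdf_support hX)//.
have -> : `]t, +oo[ `&` `]0, 1[ = `]t, 1[%classic :> set R.
  apply/seteqP; split => x /=; rewrite !in_itv/= ?andbT.
    by move=> [-> /andP[_ ->]].
  by move=> /andP[tx ->]; rewrite tx (lt_trans t0 tx).
rewrite hX// [RHS]integral_itv_bndoo; last first.
  apply/measurable_EFinP; apply: measurable_funM => //.
  by apply: measurable_funTS; exact: measurable_powR.
apply: eq_integral => x; rewrite inE/= in_itv/= => /andP[tx x1].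
by rewrite /power_pdf patchE ifT// inE/= in_itv/= (lt_trans t0 tx) x1.
Qed.

Lemma power_support (d : measure_display) (T : measurableType d)
    (R : realType) (P : probability T R) (X : {RV P >-> R}) (C p : R) :
  has_pdf X (power_pdf C p) -> distribution P X `]0, 1[ = 1%E.
Proof.
move=> hX; rewrite -[LHS](_ : distribution P X (setT `&` `]0, 1[) = _).
  by rewrite (power_pdf_support hX)// probability_setT.
by rewrite setTI.
Qed.

(** As [t] decreases to [0] the unnormalised tail tends to [C / p], while by
    right-continuity it tends to [P (X > 0) = 1]; hence [C = p]. *)
Lemma power_ccdf (d : measure_display) (T : measurableType d)
    (R : realType) (P : probability T R) (X : {RV P >-> R}) (C p t : R) :
  0 < p -> has_pdf X (power_pdf C p) -> 0 < t < 1 ->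
  ccdf X t = (1 - t `^ p)%:E.
Proof.
move=> p0 hX t01; rewrite (power_ccdf_unnormalised p0 hX t01).
suff -> : C / p = 1 by rewrite mul1r.
have cc0 : ccdf X 0 = 1%E.
  rewrite /ccdf -(power_pdf_support hX)// -(power_support hX).
  congr (distribution P X _); apply/seteqP; split => x /=;
    rewrite !in_itv/= ?andbT; first by move=> [].
  by move=> /andP[-> ->].
apply: EFin_inj; rewrite -[RHS]cc0.
apply: (@cvg_unique _ _ (ccdf X t @[t --> 0^'+])) => //; last first.
  exact: ccdf_right_continuous.
have : (C / p * (1 - t `^ p))%:E @[t --> 0^'+] --> (C / p * (1 - 0))%:E.
  apply: cvg_EFin; first by near=> u.
  by apply: cvgMr; apply: cvgB; [exact: cvg_cst|exact: powR_cvg0].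
rewrite subr0 mulr1; apply: cvg_trans; apply: near_eq_cvg.
near=> u; rewrite (power_ccdf_unnormalised p0 hX)//.
by apply/andP; split; near: u; [exact: nbhs_right_gt|exact: nbhs_right_lt].
Unshelve. all: by end_near. Qed.

(** * Mean and variance from the tail *)

Lemma ae_unit_interval (d : measure_display) (T : measurableType d)
    (R : realType) (P : probability T R) (X : {RV P >-> R}) :
  distribution P X `]0, 1[ = 1%E -> {ae P, forall w, 0 < X w < 1}.
Proof.
move=> X01; exists (X @^-1` (~` `]0, 1[)); split.
- rewrite -[X in measurable X]setTI; apply: measurable_funPT => //.
  exact: measurableC.
- rewrite -[LHS]/(distribution P X (~` `]0, 1[)) probability_setC//.
  by rewrite [X in (_ - X)%E]X01 subee.
- by move=> w /= nw; rewrite in_itv.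
Qed.

(** Almost surely [X <= t + 1_(X > t)], as [X < 1]; integrate. *)
Lemma normr_mean_le (d : measure_display) (T : measurableType d)
    (R : realType) (P : probability T R) (X : {RV P >-> R}) (t : R) :
  0 <= t -> {ae P, forall w, 0 < X w < 1} ->
  `|fine 'E_P[X]| <= t + fine (ccdf X t).
Proof.
move=> t0 X01; pose A := X @^-1` `]t, +oo[.
have mA : measurable A.
  by rewrite -[X in measurable X]setTI; exact: measurable_funPT.
have cE : ccdf X t = P A by [].
have iE : (\int[P]_w (t + \1_A w)%:E = t%:E + P A)%E.
  under eq_integral do rewrite EFinD.
  rewrite ge0_integralD//=.
  - rewrite integral_cst// [X in (_ * X)%E]probability_setT mule1.
    by rewrite integral_indic// setIT.
  - by apply/measurable_EFinP.
have EX : (`|'E_P[X]| <= t%:E + P A)%E.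
  rewrite -iE unlock; apply: (le_trans (le_abse_integral _ _ _)) => //.
    by apply/measurable_EFinP.
  apply: ae_ge0_le_integral => //.
  - by apply: measurableT_comp => //; apply/measurable_EFinP.
  - by move=> w _; rewrite lee_fin addr_ge0.
  - by apply/measurable_EFinP; apply: measurable_funD.
  - apply: filterS X01 => w /andP[w0 w1] _; rewrite lee_fin gtr0_norm// indicE.
    have [_|] := boolP (w \in A); first by rewrite ler_wpDl// ltW.
    by rewrite notin_setE /A/= in_itv/= andbT addr0 => /negP; rewrite -leNgt.
have PA : P A \is a fin_num by exact: fin_num_measure.
have fE : 'E_P[X]%E \is a fin_num.
  rewrite fin_num_abs (le_lt_trans EX)//.
  by rewrite -ge0_fin_numE ?adde_ge0 ?fin_numD ?PA.
rewrite -lee_fin EFinD cE fineK// -fine_abse// fineK//.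
by rewrite abse_fin_num.
Qed.

(** Without this, [fine] could turn an infinite variance into [0]. *)
Lemma variance_fin_num (d : measure_display) (T : measurableType d)
    (R : realType) (P : probability T R) (X : {RV P >-> R}) :
  {ae P, forall w, 0 < X w < 1} -> 'V_P[X] \is a fin_num.
Proof.
move=> X01; rewrite ge0_fin_numE ?variance_ge0//.
set m := fine 'E_P[X].
apply: (@le_lt_trans _ _ ((1 + `|m|) ^+ 2)%:E); last exact: ltry.
rewrite /variance covariance.unlock -/m expectation.unlock.
have <- : (\int[P]_w ((1 + `|m|) ^+ 2)%:E = ((1 + `|m|) ^+ 2)%:E)%E.
  by rewrite integral_cst// [X in (_ * X)%E]probability_setT mule1.
apply: ae_ge0_le_integral => //.
- by move=> w _; rewrite lee_fin sqr_ge0.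
- apply/measurable_EFinP; apply: measurable_funM; exact: measurable_funB.
- apply: filterS X01 => w /andP[w0 w1] _; rewrite lee_fin.
  apply: (@le_trans _ _ ((X w - m) ^+ 2)); first by rewrite expr2.
  rewrite -[leLHS]real_normK ?num_real// lerXn2r ?nnegrE ?addr_ge0//.
  by rewrite (le_trans (ler_normB _ _))// lerD2r gtr0_norm// ltW.
Qed.

Lemma measurable_deviation (d : measure_display) (T : measurableType d)
    (R : realType) (P : probability T R) (X : {RV P >-> R}) (a c : R) :
  measurable [set w | a <= `|X w - c|].
Proof.
have mY : measurable_fun setT (fun w => `|X w - c|).
  by apply: measurableT_comp => //; exact: measurable_funB.
have -> : [set w | a <= `|X w - c|] = (fun w => `|X w - c|) @^-1` `[a, +oo[.
  by apply/seteqP; split => w /=; rewrite in_itv/= andbT.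
by rewrite -[X in measurable X]setTI; exact: mY.
Qed.

(** Chebyshev's inequality with radius [1/4], used as a lower bound on the
    variance: if the mean is at most [1/4], then [X > 1/2] is a deviation of at
    least [1/4]. *)
Lemma tail_half_le_variance (d : measure_display) (T : measurableType d)
    (R : realType) (P : probability T R) (X : {RV P >-> R}) :
  {ae P, forall w, 0 < X w < 1} -> fine 'E_P[X] <= 4^-1 ->
  fine (ccdf X 2^-1) / 16 <= fine 'V_P[X].
Proof.
move=> X01 mu4; have VX := variance_fin_num X01.
have q0 : 0 < 4^-1 :> R by rewrite invr_gt0.
have := chebyshev X q0.
have le_ccdf : (ccdf X 2^-1 <=
    P [set w | 4^-1 <= `|X w - fine 'E_P[X]|]%R)%E.
  apply: (@le_measure _ _ _ P (X @^-1` `]2^-1, +oo[)); rewrite ?inE.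
  - by rewrite -[X in measurable X]setTI; exact: measurable_funPT.
  - exact: measurable_deviation.
  - move=> w /=; rewrite in_itv/= andbT => Xw.
    by rewrite (le_trans _ (ler_norm _))//; lra.
move=> /(le_trans le_ccdf).
have cc : ccdf X 2^-1 \is a fin_num by exact: fin_num_measure.
rewrite -[X in (X <= _)%E -> _]fineK// -[X in (_ * X)%E]fineK// -EFinM lee_fin.
rewrite exprVn invrK; lra.
Qed.

(** * Concentration of the power law as its exponent tends to zero *)

(** From [1 - exp u <= - u] with [u = 4 s ^ 4 ln s], and [- ln s <= 1 / s].
    The fourth power is what makes this [o (sqrt p)] for [p = s ^ 4]. *)
Lemma one_sub_powR_self_le (R : realType) (s : R) : 0 < s ->
  1 - (s ^+ 4) `^ (s ^+ 4) <= 4 * s ^+ 3.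
Proof.
move=> s0; have s40 : 0 < s ^+ 4 by rewrite exprn_gt0.
rewrite /powR gt_eqF// lnXn//.
have lns : - s^-1 <= ln s.
  by rewrite lerNl -lnV ?posrE// ltW// ln_sublinear// invr_gt0.
have := expR_ge1Dx (s ^+ 4 * (ln s *+ 4)).
have : - (4 * s ^+ 3) <= s ^+ 4 * (ln s *+ 4).
  have -> : - (4 * s ^+ 3) = s ^+ 4 * (- s^-1 *+ 4) by field; rewrite gt_eqF.
  by rewrite ler_wpM2l ?(ltW s40)// lerMn2r.
lra.
Qed.

(** [(1/2) ^ p <= exp (- p / 2) <= 1 / (1 + p / 2)]. *)
Lemma third_le_one_sub_powR_half (R : realType) (p : R) : 0 < p <= 1 ->
  p / 3 <= 1 - 2^-1 `^ p.
Proof.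
move=> /andP[p0 p1]; rewrite /powR gt_eqF ?invr_gt0//.
have ln2 : ln (2^-1 : R) <= - 2^-1.
  have -> : ln 2^-1 = ln (1 + - 2^-1) :> R by congr ln; field.
  by rewrite le_ln1Dx//; lra.
have e2 : expR (p * ln 2^-1) <= (1 + p / 2)^-1.
  apply: (@le_trans _ _ (expR (- (p / 2)))).
    by rewrite ler_expR -mulrN ler_wpM2l// ltW.
  by rewrite expRN lef_pV2 ?posrE ?expR_gt0 ?expR_ge1Dx//; lra.
apply: (@le_trans _ _ (1 - (1 + p / 2)^-1)); last by rewrite lerB.
have -> : 1 - (1 + p / 2)^-1 = p / (2 + p) by field; lra.
by rewrite ler_wpM2l ?(ltW p0)// lef_pV2 ?posrE; lra.
Qed.

(** If [0 < X <= p] then [`|X - E X| <= p + 5 s ^ 3 <= 6 s ^ 3], whereas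
    [y * sigma >= 50 s * (s ^ 2 / 7) > 6 s ^ 3]: the deviation event lies,
    up to a null set, in [X > p]. *)
Lemma power_law_concentration (d : measure_display) (T : measurableType d)
    (R : realType) (P : probability T R) (X : {RV P >-> R}) (C s y : R) :
  0 < s <= 4^-1 -> 50 * s <= y -> has_pdf X (power_pdf C (s ^+ 4)) ->
  (P [set w | y * Num.sqrt (fine 'V_P[X]) <= `|X w - fine 'E_P[X]| ]%R
    <= (4 * s ^+ 3)%:E)%E.
Proof.
move=> /andP[s0 s4] sy hX; set p := s ^+ 4; set mu := fine 'E_P[X].
have p0 : 0 < p by rewrite exprn_gt0.
have s30 : 0 < s ^+ 3 by rewrite exprn_gt0.
have pE : p = s * s ^+ 3 by rewrite -exprS.
have s3s2 : s ^+ 3 <= s ^+ 2 / 4 by rewrite exprS mulrC ler_wpM2l// sqr_ge0.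
have s216 : s ^+ 2 <= 16^-1.
  by rewrite expr2; nra.
have ps3 : p <= s ^+ 3 by rewrite pE; nra.
have p01 : 0 < p < 1 by rewrite p0/=; lra.
have half01 : 0 < (2^-1 : R) < 1 by lra.
have X01 := ae_unit_interval (power_support hX).
have tailE t : 0 < t < 1 -> ccdf X t = (1 - t `^ p)%:E.
  exact: (power_ccdf p0 hX).
have tail_p : ccdf X p = (1 - p `^ p)%:E by exact: tailE.
have tail_p_le : 1 - p `^ p <= 4 * s ^+ 3 by exact: one_sub_powR_self_le.
have mu_le : `|mu| <= 5 * s ^+ 3.
  by have := normr_mean_le (ltW p0) X01; rewrite tail_p/= -/mu; lra.
have var_ge : p / 48 <= fine 'V_P[X].
  have mu4 : mu <= 4^-1 by have := ler_norm mu; lra.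
  have := tail_half_le_variance X01 mu4; rewrite (tailE _ half01)/=.
  have : p / 3 <= 1 - 2^-1 `^ p by apply: third_le_one_sub_powR_half; lra.
  lra.
have sd_ge : s ^+ 2 / 7 <= Num.sqrt (fine 'V_P[X]).
  rewrite -[leLHS]ger0_norm ?divr_ge0 ?sqr_ge0// -sqrtr_sqr.
  rewrite ler_sqrt; last first.
    by rewrite (le_trans _ var_ge)// divr_ge0// ltW.
  rewrite (le_trans _ var_ge)// expr_div_n -exprM -/p; lra.
apply: (@le_trans _ _ (ccdf X p)); last by rewrite tail_p lee_fin.
have [N [mN PN0 Nsub]] := X01.
have mA : measurable (X @^-1` `]p, +oo[).
  by rewrite -[X in measurable X]setTI; exact: measurable_funPT.
rewrite -[leRHS]adde0 -PN0.
apply: le_trans (measureU2 _ mA mN).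
apply: le_measure; rewrite ?inE.
- exact: measurable_deviation.
- exact: measurableU.
- move=> w /= dev; have [Xw|nXw] := boolP (0 < X w < 1); last first.
    by right; apply: Nsub => /= h; rewrite h in nXw.
  left; rewrite in_itv/= andbT ltNge; apply/negP => Xp.
  have : `|X w - mu| <= 6 * s ^+ 3.
    rewrite (le_trans (ler_normB _ _))// gtr0_norm; first by lra.
    by case/andP: Xw.
  have : 50 * s * (s ^+ 2 / 7) <= y * Num.sqrt (fine 'V_P[X]).
    by rewrite ler_pM// ?mulr_ge0 ?invr_ge0 ?sqr_ge0// ltW.
  have : s * s ^+ 2 = s ^+ 3 by rewrite -exprS.
  lra.
Qed.

Theorem proposition3p9 (R : realType)
    (d : R -> R -> measure_display)
    (T : forall p q : R, measurableType (d p q))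
    (P : forall p q : R, probability (T p q) R)
    (X : forall p q : R, {RV (P p q) >-> R})
    (X_beta : forall p q : R, 0 < p -> 0 < q ->
      has_pdf (X p q) (real_beta_pdf p q))
    (y : R) (y_gt0 : 0 < y) :
  ereal_inf [set r : \bar R | exists p q : R, [/\ 0 < p, 0 < q &
    r = P p q [set w | y * Num.sqrt (fine 'V_(P p q)[X p q])
                       <= `|X p q w - fine 'E_(P p q)[X p q]|]]] = 0%E.
Proof.
apply/eqP; rewrite eq_le; apply/andP; split; last first.
  by apply: le_ereal_inf_tmp => _ [p [q [_ _ ->]]]; exact: measure_ge0.
apply/lee_addgt0Pr => e e0; rewrite add0e.
(* [s <= 1/4] and [s <= e] give [4 * s ^ 3 <= e]. *)
pose s := Num.min (Num.min 4^-1 (y / 50)) e.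
have s0 : 0 < s by rewrite !lt_min invr_gt0 divr_gt0//= e0 ltr0n.
have [s4 sy se] : [/\ s <= 4^-1, s <= y / 50 & s <= e].
  have : s <= s by []; rewrite {2}/s !le_min => /andP[/andP[]]; by split.
apply: (@le_trans _ _ (4 * s ^+ 3)%:E); last first.
  have : s ^+ 2 <= 16^-1 by nra.
  by rewrite lee_fin exprS => ?; nra.
have p0 : 0 < s ^+ 4 by rewrite exprn_gt0.
have hX := X_beta _ _ p0 ltr01; rewrite real_beta_pdf1 in hX.
apply: ge_ereal_inf; eexists; first by exists (s ^+ 4), 1; split.
by apply: (power_law_concentration _ _ hX); [rewrite s0|lra].
Qed.
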